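(* Let $s\ge 1$ and $k=ds+r$ be integers, where $d\ge 2$ and $1\le r\le s$. Then $$B(x)=\frac{1}{1-rH_d(x)-(s-r)H_{d-1}(x)},$$ where, for each $d$, $$H_d(x)=\sum_{\ell=0}^d\frac{x^2(1-q)\left(U_{\ell+1}\!\left(\frac{1}{2x(1-q)}\right)+U_\ell\!\left(\frac{1}{2x(1-q)}\right)+(-1)^\ell\right)^2}{(1+2x(1-q))^2\,U_{\ell+1}\!\left(\frac{1}{2x(1-q)}\right)U_\ell\!\left(\frac{1}{2x(1-q)}\right)}$$ and $U_n(t)$ denotes the $n$-th Chebyshev polynomial of the second kind.
   Context: For a $k$-ary word $\rho=\rho_1\cdots\rho_n\in\{1,\dots,k\}^n$, let $\nu(\rho)$ be the number of indices $i\in\{1,\dots,n-1\}$ with $|\rho_{i+1}-\rho_i|=s$ (occurrences of the string $a(a\pm s)$). With $q$ an indeterminate, $b_n=\sum_{\rho\in\{1,\dots,k\}^n}q^{\nu(\rho)}$ for $n\ge 1$, $b_0=1$, and $B(x)=\sum_{n\ge 0}b_nx^n$. The Chebyshev polynomials of the second kind satisfy $U_0(t)=1$, $U_1(t)=2t$, $U_n(t)=2tU_{n-1}(t)-U_{n-2}(t)$. The identity is one of rational functions in $x$ and $q$ (with $B(x)$ their power series expansion in $x$). *)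

(* Defs.v *)
From mathcomp Require Import all_boot all_order all_algebra.
Set Implicit Arguments.
Unset Strict Implicit.
Unset Printing Implicit Defensive.
Import GRing.Theory.
Local Open Scope ring_scope.

Fixpoint chebyshevU (R : comNzRingType) (n : nat) : {poly R} :=
  match n with
  | 0 => 1
  | n1.+1 => match n1 with
             | 0 => 2 *: 'X
             | n2.+1 => 2 *: 'X * chebyshevU R n1 - chebyshevU R n2
             end
  end.

(* Letters are numbered from 0 in 'I_k; only their differences matter.
   `|a - b|%N is the distance between the naturals a and b. *)
Definition nu (s k : nat) (rho : seq 'I_k) : nat :=
  let w := map val rho in
  #|[set i : 'I_(size w).-1 | `|nth 0 w i.+1 - nth 0 w i|%N == s]|.

(* Polynomials in the indeterminate q = 'X; b_0 = 1 is the contribution of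
   the empty word. *)
Definition b (s k n : nat) : {poly rat} :=
  \sum_(rho : n.-tuple 'I_k) 'X ^+ nu s rho.

(* f is regular at 0 and \sum_n c_n x^n is its expansion at x = 0: f = N / D
   with D(0) != 0, and D(x) * \sum_n c_n x^n = N(x) as formal power series.
   Such a c is unique and does not depend on the choice of N and D. *)
Definition is_series_expansion (R : idomainType)
    (f : {fraction {poly R}}) (c : nat -> R) : Prop :=
  exists N D : {poly R},
    [/\ D`_0 != 0, f = tofrac N / tofrac D
      & forall n, \sum_(i < n.+1) D`_i * c (n - i)%N = N`_n].

(* The field Q(q, x), as the fraction field of Q[q][x]. *)
Definition ratfun : fieldType := {fraction {poly {poly rat}}}.
Definition x : ratfun := tofrac ('X : {poly {poly rat}}).
Definition q : ratfun := tofrac (('X : {poly rat})%:P).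

Definition U (n : nat) : ratfun := (chebyshevU ratfun n).[1 / (2 * x * (1 - q))].

Definition H (d : nat) : ratfun :=
  \sum_(l < d.+1)
    (x ^+ 2 * (1 - q) * (U l.+1 + U l + (-1) ^+ l) ^+ 2)
    / ((1 + 2 * x * (1 - q)) ^+ 2 * U l.+1 * U l).

(* Main.v *)
Require Import Defs.
From mathcomp Require Import all_boot all_order all_algebra.
From mathcomp Require Import zify ring.
Set Implicit Arguments.
Unset Strict Implicit.
Unset Printing Implicit Defensive.
Import GRing.Theory.
Local Open Scope ring_scope.

(** Write z = x(1-q) and let A be the adjacency matrix of the graph on the
    letters in which a and c are joined when |c - a| = s.  Let V_a be the
    generating function of the words a :: t, with x marking the letters of t.
    The second letter multiplies the weight by q when it is a neighbour of a
    and by 1 otherwise, so every entry of (I + zA)V is B, while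
    B = 1 + x sum_a V_a.  If every entry of (I + zA)y is E, pairing y with V and
    using the symmetry of A gives E(B - 1) = x (sum_a y_a) B, that is
    B = E / (E - x sum_a y_a).  This is [transfer_matrix_series].

    The graph splits along the residues modulo s: for k = ds + r it consists of
    r paths with d + 1 vertices and s - r paths with d vertices.  On a path with
    m vertices, D_m = det(I + zA) = z^m U_m(1/(2z)) satisfies the recurrence
    D_{m+1} = D_m - z^2 D_{m-1}, and the system can be solved explicitly: a
    constant corrected by the two solutions of the homogeneous recurrence that
    vanish at one end ([pathsol_eq]).  Hence E may be taken to be
    (1 + 2z) D_{d+1} D_d, a polynomial with constant term 1, which makes the
    quotient regular at x = 0.

    Finally, if every entry of (I + zA)y is 1 on one path with m vertices, then
    x (sum y) is H_{m-1}.  The sum has a closed form ([sum_pathsol]), and its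
    increment from m to m + 1 is exactly the summand of index m by the Cassini
    identity D_m^2 - D_{m+1} D_{m-1} = z^(2m) ([sum_cheb_terms]).  Everything is computed over an arbitrary commutative
    ring or field; the field Q(q, x) only enters through an injective morphism
    from polynomials ([inv_cheb_sum_morph]). *)

(** * Determinants of paths *)

(** The determinant of I + zA for the path with n - 1 vertices.  The shift by
    one makes the value 0 at n = 0 available, which is the boundary condition of
    the recurrence. *)
Fixpoint pathdet {R : comNzRingType} (z : R) (n : nat) : R :=
  match n with
  | 0 => 0
  | n1.+1 => match n1 with
             | 0 => 1
             | n2.+1 => pathdet z n1 - z ^+ 2 * pathdet z n2
             end
  end.
Arguments pathdet : simpl never.

Lemma pathdet0 {R : comNzRingType} (z : R) : pathdet z 0 = 0.
Proof. by []. Qed.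

Lemma pathdet1 {R : comNzRingType} (z : R) : pathdet z 1 = 1.
Proof. by []. Qed.

Lemma pathdetSS {R : comNzRingType} (z : R) n :
  pathdet z n.+2 = pathdet z n.+1 - z ^+ 2 * pathdet z n.
Proof. by []. Qed.

Lemma pathdet_rmorph {R T : comNzRingType} (f : {rmorphism R -> T}) (z : R) n :
  f (pathdet z n) = pathdet (f z) n.
Proof.
suff [] : f (pathdet z n) = pathdet (f z) n
       /\ f (pathdet z n.+1) = pathdet (f z) n.+1 by [].
elim: n => [|n [IH0 IH1]]; first by rewrite !pathdet0 !pathdet1 rmorph0 rmorph1.
by split=> //; rewrite !pathdetSS rmorphB rmorphM rmorphXn IH0 IH1.
Qed.

(** The recurrence has determinant z^2, so this quadratic expression is
    multiplied by z^2 at each step. *)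
Lemma pathdet_cassini {R : comNzRingType} (z : R) n :
  pathdet z n.+1 ^+ 2 - pathdet z n.+2 * pathdet z n = z ^+ n.*2.
Proof.
elim: n => [|n IH]; first by rewrite pathdetSS pathdet0 pathdet1 expr0; ring.
rewrite doubleS [z ^+ _.+2]exprSr [z ^+ _.+1]exprSr -IH.
by rewrite (pathdetSS z n.+1) (pathdetSS z n); ring.
Qed.

(** * The linear system on a path *)

(** On the path with vertices 1, ..., m, this is (1 + 2z) det(I + zA) times the
    vector y for which every entry of (I + zA)y is 1.  On an infinite line the constant 1/(1 + 2z) would be
    a solution; the two subtracted terms solve the homogeneous recurrence and
    equal the first one at the ends m + 1 and 0, respectively. *)
Definition pathsol {R : comNzRingType} (z : R) (m j : nat) : R :=
  pathdet z m.+1 - (- z) ^+ (m.+1 - j) * pathdet z j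
                 - (- z) ^+ j * pathdet z (m.+1 - j).

Lemma pathsol0 {R : comNzRingType} (z : R) m : pathsol z m 0 = 0.
Proof. by rewrite /pathsol subn0 expr0 pathdet0; ring. Qed.

Lemma pathsol_end {R : comNzRingType} (z : R) m : pathsol z m m.+1 = 0.
Proof. by rewrite /pathsol subnn expr0 pathdet0; ring. Qed.

Lemma pathsol_eq {R : comNzRingType} (z : R) m j : (j < m)%N ->
  pathsol z m j.+1 + z * (pathsol z m j + pathsol z m j.+2)
  = (1 + 2 * z) * pathdet z m.+1.
Proof.
move=> lt_jm; have [p ->] : exists p, m = (j + p).+1 by exists (m - j.+1)%N; lia.
rewrite /pathsol.
have -> : ((j + p).+2 - j.+1)%N = p.+1 by lia.
have -> : ((j + p).+2 - j)%N = p.+2 by lia.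
have -> : ((j + p).+2 - j.+2)%N = p by lia.
rewrite (pathdetSS z j) (pathdetSS z p) !exprS.
by ring.
Qed.

(** The sum S_m satisfies S_{m+1} = -z (S_m + pathdet z m.+1); multiplied by
    1 + 2z, it closes up because of the recurrence of [pathdet]. *)
Lemma sum_pathdet_alt {R : comNzRingType} (z : R) m :
  (1 + 2 * z) * (\sum_(j < m) (- z) ^+ (m - j) * pathdet z j.+1)
  = - z * pathdet z m.+1 - z ^+ 2 * pathdet z m - (- z) ^+ m.+1.
Proof.
elim: m => [|m IH]; first by rewrite big_ord0 expr1 pathdet0 pathdet1; ring.
have -> : \sum_(j < m.+1) (- z) ^+ (m.+1 - j) * pathdet z j.+1
   = - z * (\sum_(j < m) (- z) ^+ (m - j) * pathdet z j.+1 + pathdet z m.+1).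
  rewrite big_ord_recr /= subSnn expr1 mulrDr mulr_sumr; congr (_ + _).
  by apply: eq_bigr => j _; rewrite subSn 1?ltnW // exprS mulrA.
rewrite mulrCA mulrDr IH (pathdetSS z m) [(- z) ^+ m.+2]exprS; ring.
Qed.

Lemma sum_pathsol {R : comNzRingType} (z : R) m :
  (1 + 2 * z) * (\sum_(j < m) pathsol z m j.+1)
  = (1 + 2 * z) * m%:R * pathdet z m.+1
    + 2 * (z * pathdet z m.+1 + z ^+ 2 * pathdet z m + (- z) ^+ m.+1).
Proof.
have sumE : \sum_(j < m) (- z) ^+ j.+1 * pathdet z (m - j)
          = \sum_(j < m) (- z) ^+ (m - j) * pathdet z j.+1.
  rewrite (reindex_inj rev_ord_inj) /=; apply: eq_bigr => j _.
  by rewrite subnSK // subKn // ltnW.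
rewrite /pathsol !sumrB sumr_const card_ord.
under eq_bigr do rewrite subSS.
under [X in _ - X]eq_bigr do rewrite subSS.
rewrite sumE -[_ *+ m]mulr_natl !mulrBr (sum_pathdet_alt z m); ring.
Qed.

(** The rescaling by z^n turns the Chebyshev recurrence at 1/(2z) into the one
    of [pathdet]. *)
Lemma pathdet_cheb {F : fieldType} (z : F) n : z != 0 -> 2 != 0 :> F ->
  pathdet z n.+1 = z ^+ n * (chebyshevU F n).[1 / (2 * z)].
Proof.
move=> z0 n2.
suff [] : pathdet z n.+1 = z ^+ n * (chebyshevU F n).[1 / (2 * z)]
  /\ pathdet z n.+2 = z ^+ n.+1 * (chebyshevU F n.+1).[1 / (2 * z)] by [].
elim: n => [|n [IH0 IH1]].
  rewrite pathdetSS pathdet1 pathdet0 /= hornerZ hornerX hornerC.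
  split; first by rewrite expr0 mulr1.
  by field; rewrite z0.
split=> //; rewrite pathdetSS IH0 IH1.
rewrite [chebyshevU F n.+2]/= hornerD hornerN hornerM hornerZ hornerX !exprS.
by field; rewrite z0.
Qed.

(** * The Chebyshev sums *)

(** Both sides vanish at m = 0.  Once the sums over paths are replaced by their
    closed form, the increments agree by the Cassini identity. *)
Lemma sum_cheb_terms (F : fieldType) (x z : F) (u : nat -> F) m :
  z != 0 -> 1 + 2 * z != 0 -> (forall n, pathdet z n.+1 != 0) ->
  (forall n, pathdet z n.+1 = z ^+ n * u n) ->
  \sum_(l < m) (x * z * (u l.+1 + u l + (-1) ^+ l) ^+ 2)
    / ((1 + 2 * z) ^+ 2 * u l.+1 * u l)
  = x * (\sum_(j < m) pathsol z m j.+1) / ((1 + 2 * z) * pathdet z m.+1).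
Proof.
move=> z0 e0 g0 gu.
have closed n : \sum_(j < n) pathsol z n j.+1 = ((1 + 2 * z) * n%:R * pathdet z n.+1
    + 2 * (z * pathdet z n.+1 + z ^+ 2 * pathdet z n + (- z) ^+ n.+1)) / (1 + 2 * z).
  by rewrite -sum_pathsol mulrAC mulfV // mul1r.
elim: m => [|m IH]; first by rewrite !big_ord0 mulr0 mul0r.
rewrite big_ord_recr /= {}IH !closed.
have zn0 n : z ^+ n != 0 by rewrite expf_neq0.
have uE n : u n = pathdet z n.+1 / z ^+ n by rewrite gu mulrAC mulfV // mul1r.
have sE : (-1) ^+ m = (- z) ^+ m / z ^+ m :> F.
  by rewrite -[- z]mulN1r exprMn mulfK.
have cassini : (- z) ^+ m ^+ 2 = pathdet z m.+1 ^+ 2 - pathdet z m.+2 * pathdet z m.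
  by rewrite pathdet_cassini -exprM exprNn -signr_odd muln2 odd_double expr0 mul1r.
(* After this the increment is a rational identity in two consecutive path
   determinants, z^m and (-z)^m, modulo the Cassini relation. *)
rewrite !uE sE.
move: (g0 m) (g0 m.+1) (zn0 m) cassini.
rewrite (pathdetSS z m) [z ^+ m.+1]exprS [(- z) ^+ m.+2]exprS [(- z) ^+ m.+1]exprS.
rewrite -[m.+1%:R]natr1.
move: (pathdet z m.+1) (pathdet z m) (z ^+ m) ((- z) ^+ m) => a b w v a0 c0 w0 vE.
by field: vE; rewrite c0 e0 w0 z0 a0.
Qed.

(** The function H over any field, with p in the role of 1 - q. *)
Definition cheb_sum {F : fieldType} (x p : F) (d : nat) : F :=
  let u n := (chebyshevU F n).[1 / (2 * x * p)] in
  \sum_(l < d.+1)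
    (x ^+ 2 * p * (u l.+1 + u l + (-1) ^+ l) ^+ 2)
    / ((1 + 2 * x * p) ^+ 2 * u l.+1 * u l).

Lemma cheb_sum_pathsol {F : fieldType} (x p : F) d :
  x * p != 0 -> 2 != 0 :> F -> 1 + 2 * (x * p) != 0 ->
  (forall n, pathdet (x * p) n.+1 != 0) ->
  cheb_sum x p d = x * (\sum_(j < d.+1) pathsol (x * p) d.+1 j.+1)
    / ((1 + 2 * (x * p)) * pathdet (x * p) d.+2).
Proof.
move=> z0 n2 e0 g0; pose u n := (chebyshevU F n).[1 / (2 * x * p)].
rewrite -(@sum_cheb_terms _ x _ u) //; last first.
  by move=> n; rewrite /u -mulrA; exact: pathdet_cheb.
by apply: eq_bigr => l _; rewrite expr2 !mulrA.
Qed.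

(** * Words and their first letter *)

Lemma sum_tupleS (V : nmodType) (T : finType) n (f : seq T -> V) :
  \sum_(t : n.+1.-tuple T) f t = \sum_(a : T) \sum_(t : n.-tuple T) f (a :: t).
Proof.
rewrite pair_bigA /= (reindex (fun p : T * n.-tuple T => [tuple of p.1 :: p.2])) //=.
exists (fun t : n.+1.-tuple T => (thead t, [tuple of behead t])).
  by case=> a t _; congr (_, _); apply: val_inj.
by move=> t _; rewrite /= -tuple_eta.
Qed.

Lemma nu_cons2 s k (a c : 'I_k) (w : seq 'I_k) :
  nu s [:: a, c & w] = ((`|c - a|%N == s) + nu s (c :: w))%N.
Proof.
rewrite /nu /= -!sum1dep_card big_mkcond big_ord_recl [in RHS]big_mkcond /=.
by congr addn; case: (_ == s).
Qed.

Lemma nu_short s k (w : seq 'I_k) : (size w <= 1)%N -> nu s w = 0%N.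
Proof.
move=> sw; apply/eqP; rewrite -leqn0 (leq_trans (max_card _)) //.
by rewrite card_ord size_map -subn1 leq_subLR addn0.
Qed.

Definition bfrom (s k n : nat) (a : 'I_k) : {poly rat} :=
  \sum_(t : n.-tuple 'I_k) 'X ^+ nu s (a :: t).

Lemma sum_tuple0 (V : nmodType) (T : finType) (f : seq T -> V) :
  \sum_(t : 0.-tuple T) f t = f [::].
Proof. by rewrite (big_pred1 [tuple]) // => t; symmetry; apply/eqP; exact: tuple0. Qed.

Lemma b0 s k : b s k 0 = 1.
Proof. by rewrite /b (sum_tuple0 (fun t : seq 'I_k => 'X ^+ nu s t)) nu_short. Qed.

Lemma bfrom0 s k (a : 'I_k) : bfrom s 0 a = 1.
Proof. by rewrite /bfrom (sum_tuple0 (fun t : seq 'I_k => 'X ^+ nu s (a :: t))) nu_short. Qed.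

Lemma bS s k n : b s k n.+1 = \sum_(a : 'I_k) bfrom s n a.
Proof. exact: (sum_tupleS _ (fun t : seq 'I_k => 'X ^+ nu s t)). Qed.

(** The second letter c contributes q = 1 - (1 - q) if it is at distance s from
    a, and 1 otherwise. *)
Lemma bfromS s k n (a : 'I_k) :
  bfrom s n.+1 a = b s k n.+1
    - (1 - 'X) * \sum_(c < k | `|c - a|%N == s) bfrom s n c.
Proof.
rewrite bS {1}/bfrom (sum_tupleS _ (fun t : seq 'I_k => 'X ^+ nu s (a :: t))).
rewrite mulr_sumr [X in _ - X]big_mkcond -sumrB; apply: eq_bigr => c _.
under eq_bigr do rewrite nu_cons2 exprD.
rewrite -mulr_sumr -/(bfrom s n c); case: eqP => _; first by rewrite expr1; ring.
by rewrite expr0; ring.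
Qed.

(** * From the linear system to the generating function *)

(** The transfer-matrix argument.  Power series are truncated after degree n,
    so every identity between them acquires an error term divisible by
    X^(n+1), which does not reach the coefficient of X^n. *)
Lemma transfer_matrix_series (R : comNzRingType) k (adj : rel 'I_k) (w : R)
    (beta : nat -> R) (v : nat -> 'I_k -> R) (y : 'I_k -> {poly R}) (E : {poly R}) :
  symmetric adj ->
  beta 0 = 1 -> (forall n, beta n.+1 = \sum_a v n a) ->
  (forall a, v 0 a = 1) ->
  (forall n a, v n.+1 a = beta n.+1 - w * \sum_(c | adj c a) v n c) ->
  (forall a, y a + 'X * w%:P * \sum_(c | adj c a) y c = E) ->
  forall n, \sum_(i < n.+1) (E - 'X * \sum_a y a)`_i * beta (n - i)%N = E`_n.
Proof.
move=> adjC beta0 betaS v0 vS yE n.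
pose T (g : nat -> R) : {poly R} := \sum_(i < n.+1) (g i)%:P * 'X ^+ i.
have TS g : T g = (g 0)%:P + 'X * T (fun i => g i.+1) - 'X ^+ n.+1 * (g n.+1)%:P.
  rewrite /T big_ord_recl [in RHS]big_ord_recr /= expr0 mulr1 mulrDr mulr_sumr.
  rewrite [X in _ + (_ + X)]mulrCA -exprS [X in _ + (_ + X)]mulrC addrA addrK.
  by congr (_ + _); apply: eq_bigr => i _; rewrite mulrCA -exprS.
have Tsum (A : pred 'I_k) : T (fun i => \sum_(a | A a) v i a)
    = \sum_(a | A a) T (fun i => v i a).
  rewrite /T [RHS]exchange_big /=; apply: eq_bigr => i _.
  by rewrite rmorph_sum mulr_suml.
pose B := T beta; pose V a := T (fun i => v i a).
pose e a := (beta n.+1 - v n.+1 a)%:P.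
have BE : B = 1 + 'X * (\sum_a V a) - 'X ^+ n.+1 * (beta n.+1)%:P.
  rewrite /B TS beta0 -(Tsum xpredT); congr (_ + _ * _ - _).
  by apply: eq_bigr => i _; rewrite betaS.
have VE a : V a + 'X * w%:P * (\sum_(c | adj c a) V c) = B + 'X ^+ n.+1 * e a.
  rewrite BE /V (TS (fun i => v i a)) v0 -!Tsum.
  have -> : T (fun i => v i.+1 a) = T (fun i => \sum_a v i a)
      - w%:P * T (fun i => \sum_(c | adj c a) v i c).
    rewrite /T mulr_sumr -sumrB; apply: eq_bigr => i _.
    by rewrite vS betaS polyCB polyCM; ring.
  by rewrite /e polyCB; ring.
(* The symmetry of the adjacency relation moves the matrix from y to V. *)
have swap : \sum_a (\sum_(c | adj c a) y c) * V a
          = \sum_a y a * (\sum_(c | adj c a) V c).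
  under eq_bigr do rewrite mulr_suml.
  rewrite (exchange_big_dep xpredT) //=; apply: eq_bigr => c _.
  by rewrite mulr_sumr; apply: eq_bigl => a; rewrite adjC.
have EV : E * (\sum_a V a) = (\sum_a y a) * B + 'X ^+ n.+1 * \sum_a y a * e a.
  transitivity (\sum_a y a * (V a + 'X * w%:P * (\sum_(c | adj c a) V c))).
    transitivity (\sum_a (y a * V a
        + 'X * w%:P * ((\sum_(c | adj c a) y c) * V a))).
      by rewrite mulr_sumr; apply: eq_bigr => a _; rewrite -(yE a); ring.
    rewrite big_split /= -mulr_sumr swap mulr_sumr -big_split /=.
    by apply: eq_bigr => a _; ring.
  rewrite mulr_suml mulr_sumr -big_split /=; apply: eq_bigr => a _.
  by rewrite VE; ring.
have DB : (E - 'X * \sum_a y a) * B = E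
    + 'X ^+ n.+1 * ('X * (\sum_a y a * e a) - E * (beta n.+1)%:P).
  have EB : E * B = E + 'X * (E * \sum_a V a) - 'X ^+ n.+1 * (E * (beta n.+1)%:P).
    by rewrite BE; ring.
  by rewrite mulrBl EB EV; ring.
have Bcoef i : (i < n.+1)%N -> B`_i = beta i.
  move=> lt_in; rewrite /B /T.
  under eq_bigr do rewrite mul_polyC.
  by rewrite -poly_def coef_poly lt_in.
transitivity (((E - 'X * \sum_a y a) * B)`_n).
  by rewrite coefM; apply: eq_bigr => i _; rewrite Bcoef // ltnS leq_subr.
by rewrite DB coefD coefXnM ltnSn addr0.
Qed.

(** * The linear system on all letters *)

Lemma sum_dist (V : nmodType) (s k a : nat) (f : nat -> V) :
  (0 < s)%N -> (a < k)%N ->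
  \sum_(c < k | `|c - a|%N == s) f c
  = (if (s <= a)%N then f (a - s)%N else 0)
    + (if (a + s < k)%N then f (a + s)%N else 0).
Proof.
move=> s0 ak; rewrite (bigID (fun c : 'I_k => (c < a)%N)) /=; congr (_ + _).
  case: leqP => sa.
    have lt_k : (a - s < k)%N by lia.
    by rewrite (big_pred1 (Ordinal lt_k)) // => c; rewrite /= -val_eqE /=; lia.
  by rewrite big_pred0 // => c; lia.
case: ltnP => ask.
  by rewrite (big_pred1 (Ordinal ask)) // => c; rewrite /= -val_eqE /=; lia.
by rewrite big_pred0 // => c; have := ltn_ord c; lia.
Qed.

(** Letter a is vertex a / s + 1 of the path of its residue modulo s.  The
    factor in front brings paths of both lengths to the common right-hand side
    (1 + 2z) D_{d+1} D_d, where D_m is [pathdet z m.+1]. *)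
Definition residuesol {R : comNzRingType} (z : R) (s d r a : nat) : R :=
  if (a %% s < r)%N then pathdet z d.+1 * pathsol z d.+1 (a %/ s).+1
  else pathdet z d.+2 * pathsol z d (a %/ s).+1.

Lemma residuesol_eq {R : comNzRingType} (z : R) (s d r a : nat) :
  (0 < s)%N -> (r <= s)%N -> (a < d * s + r)%N ->
  residuesol z s d r a
    + z * (\sum_(c < d * s + r | `|c - a|%N == s) residuesol z s d r c)
  = (1 + 2 * z) * pathdet z d.+2 * pathdet z d.+1.
Proof.
move=> s0 rs ak; rewrite sum_dist //.
have ai := ltn_pmod a s0.
have aE := divn_eq a s.
set i := (a %% s)%N in ai aE *; set j := (a %/ s)%N in aE *.
pose m := if (i < r)%N then d.+1 else d.
have jm : (j < m)%N by rewrite /m; case: ifP => ?; nia.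
pose g := if (i < r)%N then pathdet z d.+1 else pathdet z d.+2.
have solE b : b = i %[mod s] ->
    residuesol z s d r b = g * pathsol z m (b %/ s).+1.
  move=> bi; rewrite /residuesol bi (modn_small ai) /g /m.
  by case: ifP.
(* A missing neighbour sits just outside the path, where the solution is 0, so
   the letter a always sees both of its path neighbours. *)
have prev : (if (s <= a)%N then residuesol z s d r (a - s) else 0)
    = g * pathsol z m j.
  case: leqP => sa.
    have a' : a = (a - s + s)%N by rewrite subnK.
    rewrite solE; last by rewrite /i modn_mod [in RHS]a' modnDr.
    by congr (g * pathsol z m _); rewrite /j [in RHS]a' divnDr // divnn s0 addn1.
  by rewrite /j divn_small // pathsol0 mulr0.
have next : (if (a + s < d * s + r)%N then residuesol z s d r (a + s) else 0)
    = g * pathsol z m j.+2.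
  case: ltnP => ask.
    rewrite solE; last by rewrite modnDr /i modn_mod.
    by rewrite divnDr // divnn s0 addn1.
  have -> : j.+1 = m by move: ask; rewrite /m; case: ifP => ?; nia.
  by rewrite pathsol_end mulr0.
rewrite prev next solE ?modn_mod //.
have -> : (1 + 2 * z) * pathdet z d.+2 * pathdet z d.+1
    = g * ((1 + 2 * z) * pathdet z m.+1).
  by rewrite /g /m; case: ifP => _; ring.
by rewrite -(pathsol_eq z jm); ring.
Qed.

(** The residues below r occur d + 1 times among 0, ..., ds + r - 1 and the
    others d times.  Induction on d removes the first s letters, which shifts all
    the quotients by one. *)
Lemma sum_by_residue (V : nmodType) (s d r : nat) (f g : nat -> V) :
  (0 < s)%N -> (r <= s)%N ->
  \sum_(a < d * s + r) (if (a %% s < r)%N then f (a %/ s)%N else g (a %/ s)%N)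
  = (\sum_(j < d.+1) f j) *+ r + (\sum_(j < d) g j) *+ (s - r).
Proof.
move=> s0 rs; elim: d f g => [|d IH] f g.
  rewrite mul0n add0n big_ord_recl !big_ord0 mul0rn !addr0.
  rewrite -[in RHS](card_ord r) -sumr_const; apply: eq_bigr => a _.
  by have lt_as := leq_trans (ltn_ord a) rs; rewrite modn_small // divn_small // ltn_ord.
have -> : (d.+1 * s + r = s + (d * s + r))%N by lia.
rewrite big_split_ord /= [\sum_(i < d.+2) _]big_ord_recl [\sum_(i < d.+1) g _]big_ord_recl.
rewrite !mulrnDl addrACA; congr (_ + _).
  have -> : \sum_(i < s) (if (i %% s < r)%N then f (i %/ s)%N else g (i %/ s)%N)
      = \sum_(i < r + (s - r)) (if (i < r)%N then f 0 else g 0)%N.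
    by rewrite subnKC //; apply: eq_bigr => i _; rewrite modn_small // divn_small.
  rewrite big_split_ord /=; congr (_ + _).
    rewrite -[in RHS](card_ord r) -sumr_const; apply: eq_bigr => i _.
    by rewrite ltn_ord.
  rewrite -[in RHS](card_ord (s - r)) -sumr_const; apply: eq_bigr => i _.
  by rewrite ltnNge leq_addr.
rewrite -(IH (fun j => f j.+1) (fun j => g j.+1)); apply: eq_bigr => a _.
by rewrite modnDl divnDl // divnn s0 add1n.
Qed.

Lemma sum_residuesol {R : comNzRingType} (z : R) (s d r : nat) :
  (0 < s)%N -> (r <= s)%N ->
  \sum_(a < d * s + r) residuesol z s d r a
  = r%:R * pathdet z d.+1 * (\sum_(j < d.+1) pathsol z d.+1 j.+1)
    + (s - r)%:R * pathdet z d.+2 * (\sum_(j < d) pathsol z d j.+1).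
Proof.
move=> s0 rs; rewrite /residuesol.
rewrite (sum_by_residue d (fun j => pathdet z d.+1 * pathsol z d.+1 j.+1)
  (fun j => pathdet z d.+2 * pathsol z d j.+1) s0 rs) -!mulr_sumr.
by rewrite -[_ *+ r]mulr_natl -[_ *+ (s - r)]mulr_natl !mulrA.
Qed.

(** * The rational function *)

Lemma coef0_pathdet {R : comNzRingType} (w : R) n :
  (pathdet ('X * w%:P) n.+1)`_0 = 1.
Proof.
suff [] : (pathdet ('X * w%:P) n.+1)`_0 = 1
       /\ (pathdet ('X * w%:P) n.+2)`_0 = 1 by [].
elim: n => [|n [IH0 IH1]].
  by rewrite pathdetSS pathdet0 pathdet1 mulr0 subr0 coef1.
split=> //; rewrite pathdetSS coefB IH1 expr2 -!mulrA coefXM subr0.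
by [].
Qed.

Lemma inv_cheb_sum {F : fieldType} (x p : F) (s d r : nat) :
  x * p != 0 -> 2 != 0 :> F -> 1 + 2 * (x * p) != 0 ->
  (forall n, pathdet (x * p) n.+1 != 0) ->
  (0 < s)%N -> (0 < d)%N -> (r <= s)%N ->
  let E := (1 + 2 * (x * p)) * pathdet (x * p) d.+2 * pathdet (x * p) d.+1 in
  1 / (1 - r%:R * cheb_sum x p d - (s%:R - r%:R) * cheb_sum x p (d - 1))
  = E / (E - x * \sum_(a < d * s + r) residuesol (x * p) s d r a).
Proof.
move=> z0 n2 e0 g0 s0 d0 rs /=.
rewrite !cheb_sum_pathsol // sum_residuesol // -natrB //.
have -> : ((d - 1).+1 = d)%N by lia.
have := g0 d; have := g0 d.+1.
move: (x * p) e0 => z e0 c0 a0.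
rewrite -[RHS]invf_div -[RHS]div1r; congr (1 / _).
move: (pathdet z d.+2) (pathdet z d.+1) (\sum_(j < d) _) (\sum_(j < d.+1) _) c0 a0.
by move=> c a Sd Sd1 c0 a0; field; rewrite a0 c0 e0.
Qed.

Lemma residuesol_rmorph {R T : comNzRingType} (f : {rmorphism R -> T}) (z : R) s d r a :
  f (residuesol z s d r a) = residuesol (f z) s d r a.
Proof.
rewrite /residuesol /pathsol; case: ifP => _;
  by rewrite rmorphM !rmorphB !rmorphM !rmorphXn rmorphN !pathdet_rmorph.
Qed.

(** The same identity with numerator and denominator pulled back to
    polynomials.  Polynomials with constant term 1 have nonzero images, which
    yields all the divisions by [pathdet] and by 1 + 2z. *)
Lemma inv_cheb_sum_morph {R : comNzRingType} {F : fieldType} (f : {rmorphism {poly R} -> F})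
    (q : R) (s d r : nat) :
  injective f -> 2 != 0 :> R -> 1 - q != 0 ->
  (0 < s)%N -> (0 < d)%N -> (r <= s)%N ->
  let x := f 'X in let p := 1 - f q%:P in
  let z := 'X * (1 - q)%:P in
  let E := (1 + 2 * z) * pathdet z d.+2 * pathdet z d.+1 in
  1 / (1 - r%:R * cheb_sum x p d - (s%:R - r%:R) * cheb_sum x p (d - 1))
  = f E / f (E - 'X * \sum_(a < d * s + r) residuesol z s d r a).
Proof.
move=> f_inj n2 w0 s0 d0 rs x p z E.
have neq0 (P : {poly R}) : P != 0 -> f P != 0.
  by apply: contra_neq => fP; apply: f_inj; rewrite fP rmorph0.
have neq0_of_coef0 (P : {poly R}) : P`_0 = 1 -> f P != 0.
  move=> P0; apply: neq0; apply: contra_eq_neq P0 => ->.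
  by rewrite coef0 eq_sym oner_eq0.
have zE : f z = x * p by rewrite rmorphM polyCB rmorphB !rmorph1.
have e0E : f (1 + 2 * z) = 1 + 2 * (x * p).
  by rewrite rmorphD rmorphM rmorph1 rmorph_nat zE.
rewrite inv_cheb_sum //.
- rewrite rmorphB !rmorphM e0E rmorph_sum !pathdet_rmorph zE.
  by under [in RHS]eq_bigr do rewrite residuesol_rmorph zE.
- rewrite -zE neq0 //; apply: contra_neq w0 => /(congr1 (coefp 1)).
  by rewrite /= coefXM coefC coef0.
- by rewrite -(rmorph_nat f) neq0 // -polyC_natr polyC_eq0.
- by rewrite -e0E neq0_of_coef0 // coefD coef1 mulrCA coefXM addr0.
- by move=> n; rewrite -zE -pathdet_rmorph neq0_of_coef0 // coef0_pathdet.
Qed.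

Theorem theorem5p2 (s k d r : nat) (hs : (1 <= s)%N)
    (hk : k = (d * s + r)%N) (hd : (2 <= d)%N) (hr : (1 <= r <= s)%N) :
  is_series_expansion
    (1 / (1 - r%:R * H d - (s%:R - r%:R) * H (d - 1)))
    (b s k).
Proof.
have [_ rs] := andP hr; rewrite {k}hk.
pose z : {poly {poly rat}} := 'X * (1 - 'X)%:P.
pose E := (1 + 2 * z) * pathdet z d.+2 * pathdet z d.+1.
exists E, (E - 'X * \sum_(a < d * s + r) residuesol z s d r a); split.
- rewrite coefB coefXM subr0 !coef0M coefD coef1 mulrCA coefXM addr0.
  by rewrite !coef0_pathdet !mulr1 oner_eq0.
- apply: (@inv_cheb_sum_morph _ ratfun (@tofrac {poly {poly rat}}) 'X) => //.
  + by move=> p1 p2 /eqP; rewrite tofrac_eq => /eqP.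
  + by rewrite -polyC_natr polyC_eq0.
  + by rewrite -oppr_eq0 opprB polyXsubC_eq0.
  + exact: leq_trans hd.
apply: (@transfer_matrix_series _ _ (fun c a => `|c - a|%N == s) (1 - 'X) _
  (@bfrom s (d * s + r))).
- by move=> c a; rewrite distnC.
- exact: b0.
- exact: bS.
- exact: bfrom0.
- exact: bfromS.
by move=> a; exact: residuesol_eq.
Qed.
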